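(* Consider the mean--CVaR two-stage problem described in the context, with objective $$Z^{\mathrm{CVaR}}=\sum_{a\in A} f_a y_a+\sum_{i\in N}\sum_{c\in C}h_cW_{ic}+(1-\lambda)\sum_{s\in S}p_s(\mathbf y)\,Q_s+\lambda\Big[\nu+\frac1{1-\alpha}\sum_{s\in S}p_s(\mathbf y)\,\xi_s\Big],$$ under the affine decision-dependent probability model $p_s(\mathbf y)=\bar p_s+\sum_{a\in A}\delta_{sa}y_a$ for all $s\in S$, with $\mathbf y\in\{0,1\}^{A}$. Then the minimization of this objective admits an exact mixed-integer linear reformulation. In particular, suppose that valid upper bounds $0\le Q_s\le M^Q_{as}$ and $0\le \xi_s\le M^{\xi}_{as}$ are available for all $a\in A$, $s\in S$, and introduce auxiliary variables $w_{as}$, $v_{as}$ ($a\in A$, $s\in S$) standing for the products $y_aQ_s$ and $y_a\xi_s$. Then these bilinear products are represented exactly by the inequalities $$w_{as}\ge Q_s-M^Q_{as}(1-y_a),\qquad v_{as}\ge \xi_s-M^{\xi}_{as}(1-y_a),$$ $$w_{as}\le Q_s,\qquad v_{as}\le \xi_s,$$ $$w_{as}\le M^Q_{as}y_a,\qquad v_{as}\le M^{\xi}_{as}y_a,$$ $$w_{as}\ge 0,\qquad v_{as}\ge 0,$$ that is, for $y_a\in\{0,1\}$, $0\le Q_s\le M^Q_{as}$ and $0\le\xi_s\le M^\xi_{as}$, the inequalities hold if and only if $w_{as}=y_aQ_s$ and $v_{as}=y_a\xi_s$. Consequently, the full objective $Z^{\mathrm{CVaR}}$ can be written as a linear function of $(\mathbf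 y,\mathbf W,\mathbf Q,\boldsymbol\xi,\mathbf w,\mathbf v,\nu)$, and replacing the products in this way yields an equivalent mixed-integer linear program.
   Context: Data. $N$ is a finite set of nodes, $A\subseteq N\times N$ a finite set of directed arcs, $C$ a finite set of commodities, $S$ a finite set of scenarios, $R\subseteq N$ supply nodes, $D\subseteq N$ demand nodes, $\mathcal L$ a finite family of corridors, each corridor $\ell\in\mathcal L$ being a subset of $A$. Parameters: activation costs $f_a$; transport costs $c^s_{ac}$; capacities $\bar u^s_{ac}$; admissibility indicators $\theta^s_{ac}\in\{0,1\}$; demands $d_{ic}$ ($d_{ic}=0$ for $i\notin D$); supplies $r_{ic}$ ($r_{ic}=0$ for $i\notin R$); storage capacities $L_{ic}$; holding costs $h_c$; shortage penalties $\pi_c$; corridor caps $\bar\Phi_\ell$; risk weight $\lambda\in[0,1]$; CVaR level $\alpha\in(0,1)$; baseline probabilities $\bar p_s$ with $\sum_{s}\bar p_s=1$; shifts $\delta_{sa}\in\mathbb R$. Decision-dependent probabilities. $p_s(\mathbf y)=\bar p_s+\sum_{a\in A}\delta_{sa}y_a$, where it is assumed that $p_s(\mathbf y)\ge0$ for all $s\in S$ and all $\mathbf y\in\{0,1\}^A$, and $\sum_{s\in S}\delta_{sa}=0$ for all $a\in A$. First-stage variables: $y_a\in\{0,1\}$ ($a\in A$) and $0\le W_{ic}\le L_{ic}$ ($i\in N,c\in C$). Recourse. For scenario $s$, the recourse variables are $x^s_{ac}\ge0$, $I^s_{ic}\ge0$, $u^s_{ic}\ge0$ (with $u^s_{ic}=0$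 for $i\notin D$), and the recourse cost $Q_s=Q_s(\mathbf y,\mathbf W)$ is the minimum of $$\sum_{a\in A}\sum_{c\in C}c^s_{ac}x^s_{ac}+\sum_{i\in N}\sum_{c\in C}h_cI^s_{ic}+\sum_{i\in D}\sum_{c\in C}\pi_cu^s_{ic}$$ subject to, for all $i\in N$, $a\in A$, $c\in C$, $\ell\in\mathcal L$: (flow balance) $W_{ic}+r_{ic}+\sum_{(j,i)\in A}x^s_{ji,c}-\sum_{(i,j)\in A}x^s_{ij,c}-d_{ic}+u^s_{ic}=I^s_{ic}$; (capacity and admissibility) $x^s_{ac}\le\theta^s_{ac}\bar u^s_{ac}y_a$; (storage) $I^s_{ic}\le L_{ic}$; (corridor cap) $\sum_{a\in\ell}\sum_{c\in C}x^s_{ac}\le\bar\Phi_\ell\sum_{a\in A}\sum_{c\in C}x^s_{ac}$. Risk variables: $\nu\in\mathbb R$ and $\xi_s$ with $\xi_s\ge Q_s-\nu$, $\xi_s\ge0$ for all $s\in S$. The mean--CVaR problem is to minimize $Z^{\mathrm{CVaR}}$ over all these variables. In the mixed-integer linear program, $Q_s$ is treated as a continuous variable representing the (linear) recourse cost of scenario $s$, with the recourse constraints included. ''Valid upper bounds'' means bounds that may be imposed on $Q_s$ and $\xi_s$ without changing the problem. *)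

(* Defs.v *)
From HB Require Import structures.
From mathcomp Require Import all_boot all_order all_algebra.
From mathcomp Require Import all_classical all_reals ereal.

Set Implicit Arguments.
Unset Strict Implicit.
Unset Printing Implicit Defensive.
Import Order.TTheory GRing.Theory Num.Theory.
Local Open Scope classical_set_scope.
Local Open Scope ring_scope.

Record problem (R : realType) (T : Type) := Problem {
  feasible : set T;
  objective : T -> R }.

(* [+oo] for an infeasible problem, [-oo] for an unbounded one *)
Definition opt_value (R : realType) T (P : problem R T) : \bar R :=
  ereal_inf [set (objective P z)%:E | z in feasible P].

Definition optimal (R : realType) T (P : problem R T) (z : T) : Prop :=
  feasible P z /\ forall z', feasible P z' -> objective P z <= objective P z'.

Definition solvable (R : realType) T (P : problem R T) : Prop :=
  exists z, optimal P z.

Definition add_constraint (R : realType) T (P : problem R T) (F : set T) :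
  problem R T := Problem (feasible P `&` F) (objective P).

Definition same_optimum (R : realType) T T'
    (P : problem R T) (P' : problem R T') : Prop :=
  opt_value P = opt_value P' /\ (solvable P <-> solvable P').

(* [decodes z' z]: the solution [z] of [P] can be read off the solution [z']
   of [P'] *)
Definition exact_reformulation (R : realType) T T'
    (P : problem R T) (P' : problem R T') (decodes : T' -> T -> Prop) : Prop :=
  same_optimum P P' /\
  forall z', optimal P' z' -> exists2 z, optimal P z & decodes z' z.

Definition linear_form (R : realType) (V : finType) (k z : V -> R) : R :=
  \sum_v k v * z v.

(* a row [(k, b)] stands for the constraint [linear_form k z <= b] *)
Record milp (R : realType) (V : finType) := Milp {
  milp_cost : V -> R;
  milp_rows : seq ((V -> R) * R);
  milp_int : {set V} }.

Definition milp_problem (R : realType) (V : finType) (m : milp R V) :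
  problem R (V -> R) :=
  Problem
    [set z | all (fun row => linear_form row.1 z <= row.2) (milp_rows m) /\
             forall v, v \in milp_int m -> z v \is a Num.int]
    (linear_form (milp_cost m)).

(* the directed arcs; [path.arc] is another notion *)
Definition link (N : finType) (A : {set N * N}) : finType :=
  {a : N * N | a \in A}.

Record data (R : realType) (N C S L : finType) (A : {set N * N}) := Data {
  supply_nodes : {set N};
  demand_nodes : {set N};
  corridor : L -> {set link A};
  act_cost : link A -> R;                    (* f_a *)
  trans_cost : S -> link A -> C -> R;        (* c^s_ac *)
  capacity : S -> link A -> C -> R;          (* \bar u^s_ac *)
  admissible : S -> link A -> C -> bool;     (* theta^s_ac *)
  demand : N -> C -> R;                      (* d_ic *)
  supply : N -> C -> R;                      (* r_ic *)
  storage : N -> C -> R;                     (* L_ic *)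
  hold_cost : C -> R;                        (* h_c *)
  short_pen : C -> R;                        (* pi_c *)
  corridor_cap : L -> R;                     (* \bar\Phi_l *)
  risk_weight : R;                           (* lambda *)
  cvar_level : R;                            (* alpha *)
  base_prob : S -> R;                        (* \bar p_s *)
  shift : S -> link A -> R }.                (* delta_sa *)

Definition binary (R : realType) (x : R) : Prop := x = 0 \/ x = 1.

(* p_s(y) *)
Definition prob (R : realType) (N C S L : finType) (A : {set N * N})
    (d : data R C S L A) (y : link A -> R) (s : S) : R :=
  base_prob d s + \sum_a shift d s a * y a.

Record assumptions (R : realType) (N C S L : finType) (A : {set N * N})
    (d : data R C S L A) : Prop := Assumptions {
  demand_support : forall i c, i \notin demand_nodes d -> demand d i c = 0;
  supply_support : forall i c, i \notin supply_nodes d -> supply d i c = 0;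
  risk_weight_range : 0 <= risk_weight d <= 1;
  cvar_level_range : 0 < cvar_level d < 1;
  base_prob_total : \sum_s base_prob d s = 1;
  shift_total : forall a, \sum_s shift d s a = 0;
  prob_ge0 : forall y : link A -> R, (forall a, binary (y a)) ->
    forall s, 0 <= prob d y s }.

(* all variables outside the recourse problems: y_a, W_ic, Q_s, xi_s, nu *)
Inductive mvar (N C S : finType) (A : {set N * N}) : Type :=
  | Y of link A | W of N & C | Q of S | Xi of S | Nu.
Arguments Y {N C S A}.
Arguments W {N C S A}.
Arguments Q {N C S A}.
Arguments Xi {N C S A}.
Arguments Nu {N C S A}.

(* the recourse variables of one scenario: x_ac, I_ic, u_ic *)
Inductive rvar (N C : finType) (A : {set N * N}) : Type :=
  | Flow of link A & C | Stock of N & C | Short of N & C.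
Arguments Flow {N C A}.
Arguments Stock {N C A}.
Arguments Short {N C A}.

Definition mvar_code (N C S : finType) (A : {set N * N}) (v : mvar C S A) :
    link A + N * C + S + S + unit :=
  match v with
  | Y a => inl (inl (inl (inl a)))
  | W i c => inl (inl (inl (inr (i, c))))
  | Q s => inl (inl (inr s))
  | Xi s => inl (inr s)
  | Nu => inr tt
  end.

Definition mvar_decode (N C S : finType) (A : {set N * N})
    (t : link A + N * C + S + S + unit) : mvar C S A :=
  match t with
  | inl (inl (inl (inl a))) => Y a
  | inl (inl (inl (inr (i, c)))) => W i c
  | inl (inl (inr s)) => Q s
  | inl (inr s) => Xi s
  | inr _ => Nu
  end.

Lemma mvar_codeK (N C S : finType) (A : {set N * N}) :
  cancel (@mvar_code N C S A) (@mvar_decode N C S A).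
Proof. by case. Qed.

HB.instance Definition _ (N C S : finType) (A : {set N * N}) :=
  Finite.copy (mvar C S A) (can_type (@mvar_codeK N C S A)).

Definition rvar_code (N C : finType) (A : {set N * N}) (v : rvar C A) :
    link A * C + N * C + N * C :=
  match v with
  | Flow a c => inl (inl (a, c))
  | Stock i c => inl (inr (i, c))
  | Short i c => inr (i, c)
  end.

Definition rvar_decode (N C : finType) (A : {set N * N})
    (t : link A * C + N * C + N * C) : rvar C A :=
  match t with
  | inl (inl (a, c)) => Flow a c
  | inl (inr (i, c)) => Stock i c
  | inr (i, c) => Short i c
  end.

Lemma rvar_codeK (N C : finType) (A : {set N * N}) :
  cancel (@rvar_code N C A) (@rvar_decode N C A).
Proof. by case. Qed.

HB.instance Definition _ (N C : finType) (A : {set N * N}) :=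
  Finite.copy (rvar C A) (can_type (@rvar_codeK N C A)).

Notation evar C S A := (mvar C S A + S * rvar C A)%type.

Definition master_of (R : realType) (N C S : finType) (A : {set N * N})
    (z : evar C S A -> R) : mvar C S A -> R := fun v => z (inl v).

Definition recourse_of (R : realType) (N C S : finType) (A : {set N * N})
    (z : evar C S A -> R) (s : S) : rvar C A -> R := fun v => z (inr (s, v)).

Definition base_of (R : realType) (V Aux : Type) (z : V + Aux -> R) : V -> R :=
  fun v => z (inl v).

Definition recourse_cost (R : realType) (N C S L : finType) (A : {set N * N})
    (d : data R C S L A) (s : S) (r : rvar C A -> R) : R :=
  \sum_a \sum_c trans_cost d s a c * r (Flow a c)
  + \sum_i \sum_c hold_cost d c * r (Stock i c)
  + \sum_(i in demand_nodes d) \sum_c short_pen d c * r (Short i c).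

Record recourse_feasible (R : realType) (N C S L : finType) (A : {set N * N})
    (d : data R C S L A) (m : mvar C S A -> R) (s : S) (r : rvar C A -> R) :
    Prop := RecourseFeasible {
  recourse_ge0 : forall v, 0 <= r v;
  shortage_support : forall i c, i \notin demand_nodes d -> r (Short i c) = 0;
  flow_balance : forall i c,
    m (W i c) + supply d i c
    + \sum_(a : link A | (val a).2 == i) r (Flow a c)
    - \sum_(a : link A | (val a).1 == i) r (Flow a c)
    - demand d i c + r (Short i c) = r (Stock i c);
  capacity_adm : forall a c,
    r (Flow a c) <= (admissible d s a c)%:R * capacity d s a c * m (Y a);
  storage_cap : forall i c, r (Stock i c) <= storage d i c;
  corridor_bound : forall l,
    \sum_(a in corridor d l) \sum_c r (Flow a c)
    <= corridor_cap d l * \sum_a \sum_c r (Flow a c) }.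

(* [q] is the recourse cost Q_s(y, W): the minimum, which has to be attained *)
Definition is_recourse_min (R : realType) (N C S L : finType)
    (A : {set N * N}) (d : data R C S L A) (m : mvar C S A -> R) (s : S)
    (q : R) : Prop :=
  (exists2 r, recourse_feasible d m s r & recourse_cost d s r = q) /\
  (forall r, recourse_feasible d m s r -> q <= recourse_cost d s r).

Definition first_stage (R : realType) (N C S L : finType) (A : {set N * N})
    (d : data R C S L A) : set (mvar C S A -> R) :=
  [set m | (forall a, binary (m (Y a))) /\
           (forall i c, 0 <= m (W i c) <= storage d i c)].

Definition risk_constraints (R : realType) (N C S : finType)
    (A : {set N * N}) : set (mvar C S A -> R) :=
  [set m | forall s, m (Q s) - m Nu <= m (Xi s) /\ 0 <= m (Xi s)].

(* Z^CVaR *)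
Definition mean_cvar (R : realType) (N C S L : finType) (A : {set N * N})
    (d : data R C S L A) (m : mvar C S A -> R) : R :=
  let p := prob d (fun a => m (Y a)) in
  \sum_a act_cost d a * m (Y a)
  + \sum_i \sum_c hold_cost d c * m (W i c)
  + (1 - risk_weight d) * (\sum_s p s * m (Q s))
  + risk_weight d *
      (m Nu + (1 - cvar_level d)^-1 * \sum_s p s * m (Xi s)).

Definition mean_cvar_problem (R : realType) (N C S L : finType)
    (A : {set N * N}) (d : data R C S L A) : problem R (mvar C S A -> R) :=
  Problem
    [set m | [/\ first_stage d m, @risk_constraints R N C S A m
               & forall s, is_recourse_min d m s (m (Q s))]]
    (mean_cvar d).

(* The recourse constraints are explicit and Q_s is a continuous variable equal
   to the linear recourse cost, which need not be minimal; the products y_a Q_s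
   and y_a xi_s are still in the objective. *)
Definition extensive_problem (R : realType) (N C S L : finType)
    (A : {set N * N}) (d : data R C S L A) : problem R (evar C S A -> R) :=
  Problem
    [set z | let m := master_of z in
       [/\ first_stage d m, @risk_constraints R N C S A m
         & forall s, recourse_feasible d m s (recourse_of z s) /\
                     m (Q s) = recourse_cost d s (recourse_of z s)]]
    (fun z => mean_cvar d (master_of z)).

Definition within_bounds (R : realType) (N C S : finType) (A : {set N * N})
    (MQ MXi : link A -> S -> R) : set (mvar C S A -> R) :=
  [set m | forall a s, 0 <= m (Q s) <= MQ a s /\ 0 <= m (Xi s) <= MXi a s].

(* The bounds may be imposed without changing the problem.  Asking that every
   feasible point obey them would be void, since xi_s is not bounded above. *)
Definition valid_bounds (R : realType) (N C S L : finType) (A : {set N * N})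
    (d : data R C S L A) (MQ MXi : link A -> S -> R) : Prop :=
  same_optimum (mean_cvar_problem d)
    (add_constraint (mean_cvar_problem d) (@within_bounds R N C S A MQ MXi)).

(* the inequalities that make [w] the product of the binary [y] and of [q] *)
Definition product_ineqs (R : realType) (M y q w : R) : Prop :=
  [/\ w >= q - M * (1 - y), w <= q, w <= M * y & w >= 0].

Notation pvar S A := (link A * S + link A * S)%type.

Definition w_of (R : realType) (N C S : finType) (A : {set N * N})
    (z : evar C S A + pvar S A -> R) (a : link A) (s : S) : R :=
  z (inr (inl (a, s))).

Definition v_of (R : realType) (N C S : finType) (A : {set N * N})
    (z : evar C S A + pvar S A -> R) (a : link A) (s : S) : R :=
  z (inr (inr (a, s))).

(* Z^CVaR with w_as and v_as in place of y_a Q_s and y_a xi_s *)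
Definition linear_mean_cvar (R : realType) (N C S L : finType)
    (A : {set N * N}) (d : data R C S L A) (m : mvar C S A -> R)
    (w v : link A -> S -> R) : R :=
  \sum_a act_cost d a * m (Y a)
  + \sum_i \sum_c hold_cost d c * m (W i c)
  + (1 - risk_weight d) *
      (\sum_s (base_prob d s * m (Q s) + \sum_a shift d s a * w a s))
  + risk_weight d *
      (m Nu + (1 - cvar_level d)^-1 *
        \sum_s (base_prob d s * m (Xi s) + \sum_a shift d s a * v a s)).

Definition linearized_problem (R : realType) (N C S L : finType)
    (A : {set N * N}) (d : data R C S L A) (MQ MXi : link A -> S -> R) :
    problem R (evar C S A + pvar S A -> R) :=
  Problem
    [set z | let m := master_of (base_of z) in
       [/\ feasible (extensive_problem d) (base_of z),
           @within_bounds R N C S A MQ MXi m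
         & forall a s, product_ineqs (MQ a s) (m (Y a)) (m (Q s)) (w_of z a s)
             /\ product_ineqs (MXi a s) (m (Y a)) (m (Xi s)) (v_of z a s)]]
    (fun z => linear_mean_cvar d (master_of (base_of z)) (w_of z) (v_of z)).

(* A solution of the program determines y, W, xi and nu.  Its Q_s is left out:
   when its coefficient in the objective vanishes, Q_s may exceed the minimal
   recourse cost Q_s(y, W) at an optimum. *)
Definition decodes (R : realType) (N C S : finType) (A : {set N * N})
    (Aux : Type) (z : evar C S A + Aux -> R) (m : mvar C S A -> R) : Prop :=
  forall v, (forall s, v <> Q s) -> master_of (base_of z) v = m v.

Definition first_stage_in (R : realType) (N C S : finType) (A : {set N * N})
    (F : (link A -> R) -> (N -> C -> R) -> Prop) : set (mvar C S A -> R) :=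
  [set m | F (fun a => m (Y a)) (fun i c => m (W i c))].

(* [m] reformulates the problem under every side condition [F] on the
   first-stage decisions (in particular with no condition, or with a fixed
   first stage); this excludes programs obtained by solving the problem
   beforehand. *)
Definition exact_milp (R : realType) (N C S L : finType) (A : {set N * N})
    (d : data R C S L A) (Aux : finType) (m : milp R (evar C S A + Aux)%type) :
    Prop :=
  forall F : (link A -> R) -> (N -> C -> R) -> Prop,
    exact_reformulation
      (add_constraint (mean_cvar_problem d) (@first_stage_in R N C S A F))
      (add_constraint (milp_problem m)
         [set z | @first_stage_in R N C S A F (master_of (base_of z))])
      (@decodes R N C S A Aux).

(* Main.v *)
Require Import Defs.
From HB Require Import structures.
From mathcomp Require Import all_boot all_order all_algebra.
From mathcomp Require Import all_classical all_reals ereal.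
From mathcomp Require Import topology normedtype derive.
From mathcomp Require Import lra.

Set Implicit Arguments.
Unset Strict Implicit.
Unset Printing Implicit Defensive.
Import Order.TTheory GRing.Theory Num.Theory.
Local Open Scope classical_set_scope.
Local Open Scope ring_scope.

(* Each recourse problem is a linear program over a polytope, so its minimum is
   attained as soon as it is feasible.  Hence replacing the [Q s] of a feasible
   point of the extensive form by the minimal recourse costs keeps it feasible
   and does not increase the objective, the probabilities being nonnegative:
   the extensive form has the optimum of the two-stage problem, and valid bounds
   only squeeze the program between the two.  On a box, McCormick's inequalities
   pin down the products with a binary variable.  Without given bounds, a box is
   found as follows: the polytopes bound [Q s] by some [K], and [nu] can be
   clamped to [- K, K], which bounds [xi s] by [2 K]. *)

(** * Polyhedra *)

(** Coefficients stay existential, so that the rows and the cost of the final program come from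
    closure properties instead of being written out. *)
Definition affine (R : realType) (V : finType) (f : (V -> R) -> R) : Prop :=
  exists k b, forall z, f z = linear_form k z + b.

Lemma affine_cst (R : realType) (V : finType) (b : R) :
  affine (fun _ : V -> R => b).
Proof.
by exists (fun=> 0), b => z; rewrite /linear_form big1 ?add0r// => v _; rewrite mul0r.
Qed.

Lemma affine_coord (R : realType) (V : finType) (v : V) :
  affine (fun z : V -> R => z v).
Proof.
exists (fun u => (u == v)%:R), 0 => z; rewrite /linear_form addr0 (bigD1 v)//=.
by rewrite eqxx mul1r big1 ?addr0// => u /negbTE ->; rewrite mul0r.
Qed.

Lemma affineD (R : realType) (V : finType) (f g : (V -> R) -> R) :
  affine f -> affine g -> affine (fun z => f z + g z).
Proof.
move=> [k [b fE]] [l [c gE]]; exists (fun v => k v + l v), (b + c) => z.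
rewrite fE gE addrACA /linear_form -big_split/=; congr (_ + _).
by apply: eq_bigr => v _; rewrite mulrDl.
Qed.

Lemma affineZ (R : realType) (V : finType) (a : R) (f : (V -> R) -> R) :
  affine f -> affine (fun z => a * f z).
Proof.
move=> [k [b fE]]; exists (fun v => a * k v), (a * b) => z.
rewrite fE mulrDr /linear_form mulr_sumr; congr (_ + _).
by apply: eq_bigr => v _; rewrite mulrA.
Qed.

Lemma affineN (R : realType) (V : finType) (f : (V -> R) -> R) :
  affine f -> affine (fun z => - f z).
Proof.
move=> /(affineZ (-1)) [k [b fE]]; exists k, b => z.
by rewrite -fE mulN1r.
Qed.

Lemma affine_sum (R : realType) (V I : finType) (P : pred I)
    (f : I -> (V -> R) -> R) :
  (forall i, affine (f i)) -> affine (fun z => \sum_(i | P i) f i z).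
Proof.
move=> /(_ _)/cid-/all_sig[k /(_ _)/cid-/all_sig[b fE]].
exists (fun v => \sum_(i | P i) k i v), (\sum_(i | P i) b i) => z.
rewrite (eq_bigr _ (fun i _ => fE i z)) big_split/= /linear_form exchange_big/=.
by congr (_ + _); apply: eq_bigr => v _; rewrite mulr_suml.
Qed.

Ltac solve_affine :=
  repeat first [ exact: affine_cst | exact: affine_coord | solve [auto]
               | apply: affineN | apply: affineD | apply: affineZ
               | apply: affine_sum => ? ].

(** The rows have the shape of [milp_rows], so that such a set is the feasible set of a [milp] up to
    integrality. *)
Definition polyhedral (R : realType) (V : finType) (F : (V -> R) -> Prop) : Prop :=
  exists rows : seq ((V -> R) * R),
    forall z, F z <-> all (fun row => linear_form row.1 z <= row.2) rows.

Lemma eq_polyhedral (R : realType) (V : finType) (F G : (V -> R) -> Prop) :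
  (forall z, F z <-> G z) -> polyhedral G -> polyhedral F.
Proof. by move=> FG [rows GE]; exists rows => z; rewrite FG GE. Qed.

Lemma polyhedral_true (R : realType) (V : finType) :
  polyhedral (fun _ : V -> R => True).
Proof. by exists [::]. Qed.

Lemma polyhedral_le (R : realType) (V : finType) (f g : (V -> R) -> R) :
  affine f -> affine g -> polyhedral (fun z => f z <= g z).
Proof.
move=> fa /affineN /(affineD fa)[k [b fgE]]; exists [:: (k, - b)] => z.
by rewrite /= andbT -subr_le0 fgE -lerBrDr sub0r.
Qed.

Lemma polyhedral_and (R : realType) (V : finType) (F G : (V -> R) -> Prop) :
  polyhedral F -> polyhedral G -> polyhedral (fun z => F z /\ G z).
Proof.
move=> [r FE] [s GE]; exists (r ++ s) => z.
by rewrite all_cat FE GE; split => /andP.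
Qed.

Lemma polyhedral_le2 (R : realType) (V : finType) (f g h : (V -> R) -> R) :
  affine f -> affine g -> affine h -> polyhedral (fun z => f z <= g z <= h z).
Proof.
move=> fa ga ha.
apply: eq_polyhedral (polyhedral_and (polyhedral_le fa ga) (polyhedral_le ga ha)).
by move=> z; split => /andP.
Qed.

Lemma polyhedral_eq (R : realType) (V : finType) (f g : (V -> R) -> R) :
  affine f -> affine g -> polyhedral (fun z => f z = g z).
Proof.
move=> fa ga.
apply: eq_polyhedral (polyhedral_and (polyhedral_le fa ga) (polyhedral_le ga fa)).
by move=> z; split => [->//|[? ?]]; apply/eqP; rewrite eq_le; apply/andP.
Qed.

(** The premise is a fixed boolean, independent of [z]; this covers side conditions such as
    [i \notin demand_nodes d]. *)
Lemma polyhedral_imply (R : realType) (V : finType) (b : bool)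
    (F : (V -> R) -> Prop) :
  polyhedral F -> polyhedral (fun z => b -> F z).
Proof.
by case: b => pF; [apply: eq_polyhedral pF => z; split=> // /(_ isT)
  | apply: eq_polyhedral (@polyhedral_true _ _)].
Qed.

Lemma polyhedral_forall (R : realType) (V I : finType)
    (F : I -> (V -> R) -> Prop) :
  (forall i, polyhedral (F i)) -> polyhedral (fun z => forall i, F i z).
Proof.
move=> /(_ _)/cid-/all_sig[rows FE].
exists (flatten [seq rows i | i <- enum I]) => z; split.
  move=> Fz; apply/allP => row /flattenP[r /mapP[i _ ->]].
  by move: row; apply/allP/FE.
move=> /allP az i; apply/FE/allP => row rowi; apply: az.
by apply/flattenP; exists (rows i) => //; apply: map_f; rewrite mem_enum.
Qed.

Ltac solve_polyhedral :=
  repeat first [ solve [auto] | apply: polyhedral_and | apply: polyhedral_le2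
               | apply: polyhedral_le | apply: polyhedral_eq
               | apply: polyhedral_forall => ? | apply: polyhedral_imply ];
  solve_affine.

(** * Compactness and attained minima *)

Import numFieldNormedType.Exports.

Lemma linear_form_continuous (R : realType) (V : finType) (k : V -> R) :
  continuous (linear_form k : prod_topology (fun _ : V => R) -> R).
Proof.
apply: continuous_big => [|v _ z]; first exact: add_continuous.
have /= := @continuous_comp (prod_topology (fun _ : V => R)) R R
  (fun z => z v) (fun x => k v * x) z.
apply; first exact: (@proj_continuous V (fun _ => R) v).
exact: mulrl_continuous.
Qed.

Lemma polyhedral_closed (R : realType) (V : finType) (F : (V -> R) -> Prop) :
  polyhedral F -> closed (F : set (prod_topology (fun _ : V => R))).
Proof.
move=> [rows FE].
have -> : F = fun z => all (fun row => linear_form row.1 z <= row.2) rows.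
  by apply/funext => z; apply/propext/FE.
elim: rows {FE} => [|row rows IH] /=.
  rewrite (_ : (fun _ => _) = setT); first exact: closedT.
  by apply/funext => z; apply/propext.
rewrite (_ : (fun z => _) = [set z | linear_form row.1 z <= row.2] `&`
   [set z | all (fun row => linear_form row.1 z <= row.2) rows]); last first.
  by apply/funext => z; apply/propext; split => /andP.
apply: closedI => //.
apply: (@preimage_closed (prod_topology (fun _ : V => R)) R
          (linear_form row.1) [set x | x <= row.2]); last exact: closed_le.
by move=> z _; exact: linear_form_continuous.
Qed.

(** Weierstrass: [F] is closed in a product of segments, which is compact by Tychonoff, and linear
    forms are continuous for the product topology. *)
Lemma polytope_min (R : realType) (V : finType) (F : (V -> R) -> Prop)
    (B : V -> R) (f : (V -> R) -> R) :
  polyhedral F -> (forall z, F z -> forall v, 0 <= z v <= B v) -> affine f ->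
  (exists z, F z) -> exists2 z, F z & forall z', F z' -> f z <= f z'.
Proof.
move=> pF FB [k [b fE]] F0.
pose box : set (prod_topology (fun _ : V => R)) :=
  [set z | forall v, `[0, B v]%classic (z v)].
have cbox : compact box.
  by apply: (@tychonoff V (fun=> R) (fun v => `[0, B v]%classic)) => v;
    exact: segment_compact.
have cF : compact (F : set (prod_topology (fun _ : V => R))).
  apply: subclosed_compact (polyhedral_closed pF) cbox _ => z Fz v /=.
  by rewrite in_itv/= FB.
have := @compact_EVT_min (prod_topology (fun _ : V => R)) R (linear_form k) F F0 cF.
case.
  by apply: continuous_subspaceT => z; exact: linear_form_continuous.
move=> z; rewrite inE => Fz zmin; exists z => // z' Fz'.
by rewrite !fE lerD2r zmin// inE.
Qed.

(** * Problems with the same optimum *)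

Lemma opt_value_le (R : realType) T (P : problem R T) z :
  feasible P z -> (opt_value P <= (objective P z)%:E)%E.
Proof. by move=> Pz; apply: ereal_inf_lbound; exists z. Qed.

(** Optimality becomes a comparison with the value, which can be carried between problems over
    different types. *)
Lemma optimalP (R : realType) T (P : problem R T) z :
  optimal P z <-> feasible P z /\ ((objective P z)%:E <= opt_value P)%E.
Proof.
split=> -[Pz zmin]; split=> //.
  by apply: le_ereal_inf_tmp => _ [z' Pz' <-]; rewrite lee_fin zmin.
by move=> z' Pz'; rewrite -lee_fin; apply: le_trans zmin (opt_value_le Pz').
Qed.

Lemma opt_value_dominated (R : realType) T T' (P : problem R T)
    (P' : problem R T') :
  (forall z', feasible P' z' ->
     exists2 z, feasible P z & objective P z <= objective P' z') ->
  (opt_value P <= opt_value P')%E.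
Proof.
move=> dom; apply: le_ereal_inf_tmp => _ [z' /dom[z Pz zz'] <-].
by apply: le_trans (opt_value_le Pz) _; rewrite lee_fin.
Qed.

Lemma same_optimum_restrict (R : realType) T (P : problem R T) (B : set T) :
  (forall z, feasible P z ->
     exists z', [/\ feasible P z', B z' & objective P z' <= objective P z]) ->
  same_optimum P (add_constraint P B).
Proof.
move=> dom.
have optE : opt_value P = opt_value (add_constraint P B).
  apply/eqP; rewrite eq_le !opt_value_dominated// => z.
    by move=> /dom[z' [Pz' Bz' z'z]]; exists z'.
  by move=> [Pz _]; exists z.
split=> //; split=> -[z /optimalP[Pz zle]].
  have [z' [Pz' Bz' z'z]] := dom z Pz; exists z'; apply/optimalP; split=> //.
  by rewrite -optE; apply: le_trans zle; rewrite lee_fin.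
by exists z; apply/optimalP; split; [case: Pz | rewrite optE].
Qed.

(* The values are squeezed: [P] <= [P'] <= [P] restricted to [B]. *)
Lemma squeezed_reformulation (R : realType) T T' (P : problem R T)
    (P' : problem R T') (B : set T) (dec : T' -> T -> Prop) :
  same_optimum P (add_constraint P B) ->
  (forall z', feasible P' z' ->
     exists z, [/\ feasible P z, objective P z <= objective P' z' & dec z' z]) ->
  (forall z, feasible P z -> B z ->
     exists2 z', feasible P' z' & objective P' z' <= objective P z) ->
  exact_reformulation P P' dec.
Proof.
move=> [optB [solB _]] down up.
have le1 : (opt_value P <= opt_value P')%E.
  by apply: opt_value_dominated => z' /down[z [Pz zz' _]]; exists z.
have optE : opt_value P = opt_value P'.
  apply/eqP; rewrite eq_le le1/= optB opt_value_dominated// => z [].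
  exact: up.
(* The chain is [objective P z <= objective P' z' <= opt_value P' = opt_value P]. *)
have decode z' : optimal P' z' -> exists2 z, optimal P z & dec z' z.
  move=> /optimalP[/down[z [Pz zz' dz]] z'le]; exists z => //.
  by apply/optimalP; split=> //; rewrite optE; apply: le_trans z'le; rewrite lee_fin.
split=> //; split=> //; split; last by move=> [z' /decode[z zo _]]; exists z.
(* An arbitrary optimum of [P] may lie outside [B], where [up] says nothing; [solB] supplies one
   inside. *)
move=> /solB[z /optimalP[[Pz Bz] zle]].
have [z' P'z' z'z] := up z Pz Bz; exists z'; apply/optimalP; split=> //.
by rewrite -optE optB; apply: le_trans zle; rewrite lee_fin.
Qed.

(** * Recourse problems *)

(** The ambient space is arbitrary because two are used: the recourse variables alone with [m]
    constant, and all the variables of the program. *)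
Lemma polyhedral_recourse (R : realType) (N C S L V : finType)
    (A : {set N * N}) (d : data R C S L A) (s : S)
    (m : (V -> R) -> mvar C S A -> R) (r : (V -> R) -> rvar C A -> R) :
  (forall v, affine (fun z => m z v)) -> (forall v, affine (fun z => r z v)) ->
  polyhedral (fun z => recourse_feasible d (m z) s (r z)).
Proof.
move=> ma ra.
apply: (@eq_polyhedral _ _ _ (fun z =>
  (forall v, 0 <= r z v) /\
  (forall i c, i \notin demand_nodes d -> r z (Short i c) = 0) /\
  (forall i c, m z (W i c) + supply d i c
    + \sum_(a : link A | (val a).2 == i) r z (Flow a c)
    - \sum_(a : link A | (val a).1 == i) r z (Flow a c)
    - demand d i c + r z (Short i c) = r z (Stock i c)) /\
  (forall a c, r z (Flow a c)
    <= (admissible d s a c)%:R * capacity d s a c * m z (Y a)) /\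
  (forall i c, r z (Stock i c) <= storage d i c) /\
  (forall l, \sum_(a in corridor d l) \sum_c r z (Flow a c)
    <= corridor_cap d l * \sum_a \sum_c r z (Flow a c)))).
  by move=> z; split=> [[] | [? [? [? [? []]]]]].
by solve_polyhedral.
Qed.

Lemma affine_recourse_cost (R : realType) (N C S L V : finType)
    (A : {set N * N}) (d : data R C S L A) (s : S)
    (r : (V -> R) -> rvar C A -> R) :
  (forall v, affine (fun z => r z v)) ->
  affine (fun z => recourse_cost d s (r z)).
Proof. by move=> ra; rewrite /recourse_cost; solve_affine. Qed.

(** Independent of the first stage. Absolute values appear because the data carry no sign
    conditions. *)
Definition recourse_bound (R : realType) (N C S L : finType) (A : {set N * N})
    (d : data R C S L A) (s : S) (v : rvar C A) : R :=
  match v with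
  | Flow a c => `|capacity d s a c|
  | Stock i c => `|storage d i c|
  | Short i c => `|storage d i c| + `|supply d i c| + `|demand d i c|
                 + \sum_a `|capacity d s a c|
  end.

(** Flows are bounded by capacities and stocks by storage. Solving flow balance for the shortage
    bounds it too: inflow and [W] then enter with a minus sign and are nonnegative. *)
Lemma recourse_le_bound (R : realType) (N C S L : finType) (A : {set N * N})
    (d : data R C S L A) (m : mvar C S A -> R) (s : S) (r : rvar C A -> R) :
  first_stage d m -> recourse_feasible d m s r ->
  forall v, 0 <= r v <= recourse_bound d s v.
Proof.
move=> [mY mW] [r0 _ bal cap sto _].
have flow a c : r (Flow a c) <= `|capacity d s a c|.
  apply: le_trans (cap a c) _; apply: le_trans (ler_norm _) _.
  (* The factors are compared one by one: the indicator and [m (Y a)] are each at most 1 in absolute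
     value. *)
  rewrite !normrM -[`|capacity d s a c| in leRHS]mul1r -[leRHS]mulr1.
  rewrite !ler_pM ?mulr_ge0//; last by case: (mY a) => ->; rewrite ?normr0 ?normr1.
  by rewrite normr_nat; case: (admissible _ _ _ _).
case=> [a c|i c|i c]; rewrite r0//=; first exact: le_trans (sto i c) (ler_norm _).
have [W0 _] := andP (mW i c).
have into0 : 0 <= \sum_(a : link A | (val a).2 == i) r (Flow a c).
  exact: sumr_ge0.
have out : \sum_(a : link A | (val a).1 == i) r (Flow a c)
    <= \sum_a `|capacity d s a c|.
  by rewrite big_mkcond/=; apply: ler_sum => a _; case: ifP.
have := bal i c; have := sto i c; have := ler_norm (storage d i c).
have := ler_norm (demand d i c); have := lerNnormlW (lexx `|supply d i c|).
lra.
Qed.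

Lemma recourse_cost_bounded (R : realType) (N C S L : finType)
    (A : {set N * N}) (d : data R C S L A) :
  exists2 K, 0 <= K & forall m s r, first_stage d m ->
    recourse_feasible d m s r -> - K <= recourse_cost d s r <= K.
Proof.
have /(_ _)/cid-/all_sig[k /(_ _)/cid-/all_sig[b kE]] s :=
  affine_recourse_cost d s (@affine_coord R (rvar C A)).
pose K s := \sum_v `|k s v| * recourse_bound d s v + `|b s|.
(* A sum of absolute values dominates every [K s] and is nonnegative, also when there is no
   scenario. *)
exists (\sum_s `|K s|) => [|m s r ms rs]; first exact: sumr_ge0.
rewrite -ler_norml kE; apply: (@le_trans _ _ (K s)).
  apply: le_trans (ler_normD _ _) _; rewrite lerD2r.
  apply: le_trans (ler_norm_sum _ _ _) _; apply: ler_sum => v _.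
  have /andP[r0 rB] := recourse_le_bound ms rs v.
  by rewrite normrM ler_wpM2l// ger0_norm.
apply: le_trans (ler_norm _) _; rewrite (bigD1 s)//= lerDl.
exact: sumr_ge0.
Qed.

Lemma recourse_min_exists (R : realType) (N C S L : finType) (A : {set N * N})
    (d : data R C S L A) (m : mvar C S A -> R) (s : S) (r : rvar C A -> R) :
  first_stage d m -> recourse_feasible d m s r ->
  exists q, is_recourse_min d m s q.
Proof.
move=> ms rs.
have [|r' r's rmin] := polytope_min
  (polyhedral_recourse d s (fun v => affine_cst _ (m v)) (@affine_coord R _))
  (fun r => @recourse_le_bound R N C S L A d m s r ms)
  (affine_recourse_cost d s (@affine_coord R _)).
  by exists r.
by exists (recourse_cost d s r'); split=> //; exists r'.
Qed.

(** * The two-stage problem and its extensive form *)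

(** With [Y] and [W] fixed, the objective is a combination of the expected cost and the risk term
    with weights [1 - lambda] and [lambda], both nonnegative. *)
Lemma mean_cvar_le (R : realType) (N C S L : finType) (A : {set N * N})
    (d : data R C S L A) (m m' : mvar C S A -> R) :
  assumptions d ->
  (forall a, m' (Y a) = m (Y a)) -> (forall i c, m' (W i c) = m (W i c)) ->
  let p := prob d (fun a => m (Y a)) in
  \sum_s p s * m' (Q s) <= \sum_s p s * m (Q s) ->
  m' Nu + (1 - cvar_level d)^-1 * \sum_s p s * m' (Xi s)
    <= m Nu + (1 - cvar_level d)^-1 * \sum_s p s * m (Xi s) ->
  mean_cvar d m' <= mean_cvar d m.
Proof.
move=> hd eqY eqW p leQ leXi; rewrite /mean_cvar.
have -> : (fun a => m' (Y a)) = (fun a => m (Y a)) by exact/funext.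
under eq_bigr do rewrite eqY.
under [X in _ + X + _ + _]eq_bigr => i _ do under eq_bigr do rewrite eqW.
have /andP[l0 l1] := risk_weight_range hd.
by rewrite !lerD// ler_wpM2l// subr_ge0.
Qed.

Lemma is_recourse_min_ext (R : realType) (N C S L : finType) (A : {set N * N})
    (d : data R C S L A) (m m' : mvar C S A -> R) (s : S) (q : R) :
  (forall a, m' (Y a) = m (Y a)) -> (forall i c, m' (W i c) = m (W i c)) ->
  is_recourse_min d m s q -> is_recourse_min d m' s q.
Proof.
move=> eqY eqW [[r rs rq] rmin].
split; first by exists r => //; case: rs => *; split=> // *; rewrite ?eqY ?eqW.
by move=> r' [*]; apply: rmin; split=> // *; rewrite -?eqY -?eqW.
Qed.

Definition set_cost (R : realType) (N C S : finType) (A : {set N * N})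
    (m : mvar C S A -> R) (q : S -> R) (v : mvar C S A) : R :=
  match v with Q s => q s | _ => m v end.

(** Lowering each [Q s] to the minimal recourse cost preserves [xi_s >= Q_s - nu]. Only the [Q s]
    change, as [decodes] requires. *)
Lemma extensive_to_mean_cvar (R : realType) (N C S L : finType)
    (A : {set N * N}) (d : data R C S L A) (z : evar C S A -> R) :
  assumptions d -> feasible (extensive_problem d) z ->
  exists m, [/\ feasible (mean_cvar_problem d) m,
                mean_cvar d m <= mean_cvar d (master_of z)
              & forall v, (forall s, v <> Q s) -> master_of z v = m v].
Proof.
move=> hd [fs risk rec].
have /(_ _)/cid-/all_sig[q qmin] s : exists q, is_recourse_min d (master_of z) s q.
  by case: (rec s) => rs _; exact: recourse_min_exists rs.
have leq s : q s <= master_of z (Q s).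
  by case: (rec s) => rs ->; apply: (qmin s).2.
exists (set_cost (master_of z) q); split.
- split=> // s; last exact: is_recourse_min_ext (qmin s).
  by have [le1 ?] := risk s; split=> //=; apply: le_trans le1; rewrite lerD2r.
- apply: mean_cvar_le => //=; apply: ler_sum => s _.
  by rewrite ler_wpM2l//; apply: prob_ge0 => // a; case: fs.
- by case=> //= s /(_ s).
Qed.

(** Since the recourse minima are attained, minimizers can serve as recourse variables. *)
Lemma mean_cvar_to_extensive (R : realType) (N C S L : finType)
    (A : {set N * N}) (d : data R C S L A) (m : mvar C S A -> R) :
  feasible (mean_cvar_problem d) m ->
  exists2 z, feasible (extensive_problem d) z & master_of z = m.
Proof.
move=> [fs risk rec].
have /(_ _)/cid2-/all_sig2[r rs rq] s :
  exists2 r, recourse_feasible d m s r & recourse_cost d s r = m (Q s).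
  by case: (rec s).
by exists (fun v => match v with inl v => m v | inr (s, v) => r s v end).
Qed.

(** * Bounds on the risk variables *)

Lemma prob_total (R : realType) (N C S L : finType) (A : {set N * N})
    (d : data R C S L A) (y : link A -> R) :
  assumptions d -> \sum_s prob d y s = 1.
Proof.
move=> hd; rewrite big_split/= base_prob_total// exchange_big/= big1 ?addr0// => a _.
by rewrite -mulr_suml shift_total// mul0r.
Qed.

(** [nu] is projected onto [[- K, K]] and each [xi_s] is reset to the least value that the risk
    constraints then allow. *)
Definition clamp_risk (R : realType) (N C S : finType) (A : {set N * N})
    (K : R) (m : mvar C S A -> R) (v : mvar C S A) : R :=
  let nu := Num.max (- K) (Num.min K (m Nu)) in
  match v with
  | Xi s => Num.max 0 (m (Q s) - nu)
  | Nu => nu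
  | _ => m v
  end.

(* Raising [nu] to [- K] by [t] lowers every [xi_s] by at least [t], which pays
   off as [1 <= (1 - alpha)^-1]; lowering [nu] to [K] lets every [xi_s] be 0. *)
Lemma mean_cvar_clamp_risk (R : realType) (N C S L : finType)
    (A : {set N * N}) (d : data R C S L A) (K : R) (m : mvar C S A -> R) :
  assumptions d -> 0 <= K -> (forall a, binary (m (Y a))) ->
  @risk_constraints R N C S A m -> (forall s, - K <= m (Q s) <= K) ->
  mean_cvar d (clamp_risk K m) <= mean_cvar d m.
Proof.
move=> hd K0 mY risk QK.
set p := prob d (fun a => m (Y a)).
have p0 s : 0 <= p s by exact: prob_ge0.
have p1 : \sum_s p s = 1 by exact: prob_total.
have /andP[al0 al1] := cvar_level_range hd.
set g := (1 - cvar_level d)^-1.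
have g1 : 1 <= g by rewrite /g invf_ge1; lra.
apply: mean_cvar_le => //=; rewrite -/p -/g.
set nu := Num.max _ _.
(* The amount by which [nu] is raised; it is 0 when clamping lowers [nu] or leaves it alone. *)
pose t := Num.max 0 (nu - m Nu).
(* If [m Nu < - K], the left side is [m (Q s) + K = m (Q s) - m Nu - t]; if [m Nu > K], it is 0 as
   [m (Q s) <= K]; otherwise [nu = m Nu] and [t = 0]. *)
have xit s : Num.max 0 (m (Q s) - nu) <= m (Xi s) - t.
  have [? ?] := risk s; have /andP[? ?] := QK s.
  rewrite /t /nu /Num.max /Num.min; do !case: ifP => /=; lra.
have nut : nu - t <= m Nu.
  by rewrite lerBlDr -lerBlDl le_max lexx orbT.
have t0 : 0 <= t by rewrite le_max lexx.
have : \sum_s p s * Num.max 0 (m (Q s) - nu) <= \sum_s p s * m (Xi s) - t.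
  (* As the probabilities sum to 1, [t] is its own expectation and can be distributed over the
     scenarios. *)
  rewrite -[t in leRHS]mul1r -p1 mulr_suml -sumrB; apply: ler_sum => s _.
  by rewrite -mulrBr ler_wpM2l.
have : t <= g * t by rewrite ler_peMl.
have g0 : 0 <= g by lra.
move=> gt /(ler_wpM2l g0); rewrite mulrBr; lra.
Qed.

(** * Linearization *)

(** McCormick's envelope of [y * q] over [[0, 1]] times [[l, M]]. Costs may be negative, hence the
    lower bound [l]; [product_ineqs] is the case [l = 0]. *)
Definition mccormick (R : realType) (l M y q w : R) : Prop :=
  [/\ w >= q - M * (1 - y), w <= q - l * (1 - y), w <= M * y & w >= l * y].

(** At [y = 0] the last two inequalities force [w = 0], at [y = 1] the first two force [w = q]; the
    other two then follow from [l <= q <= M]. *)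
Lemma mccormickP (R : realType) (l M y q w : R) :
  binary y -> l <= q <= M -> mccormick l M y q w <-> w = y * q.
Proof.
move=> yb /andP[lq qM]; rewrite /mccormick; case: yb => ->.
  by split=> [[]|->]; [|split]; lra.
by split=> [[]|->]; [|split]; lra.
Qed.

Lemma product_ineqsE (R : realType) (M y q w : R) :
  product_ineqs M y q w <-> mccormick 0 M y q w.
Proof. by rewrite /product_ineqs /mccormick !mul0r subr0. Qed.

Definition box (R : realType) (N C S : finType) (A : {set N * N})
    (l MQ MXi : link A -> S -> R) : set (mvar C S A -> R) :=
  [set m | forall a s, l a s <= m (Q s) <= MQ a s /\ 0 <= m (Xi s) <= MXi a s].

(* [linearized_problem] for lower bounds [l a s] of [Q s] that may be
   negative. *)
Definition box_linearized (R : realType) (N C S L : finType) (A : {set N * N})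
    (d : data R C S L A) (l MQ MXi : link A -> S -> R) :
    problem R (evar C S A + pvar S A -> R) :=
  Problem
    [set z | let m := master_of (base_of z) in
       [/\ feasible (extensive_problem d) (base_of z), @box R N C S A l MQ MXi m
         & forall a s,
             mccormick (l a s) (MQ a s) (m (Y a)) (m (Q s)) (w_of z a s) /\
             mccormick 0 (MXi a s) (m (Y a)) (m (Xi s)) (v_of z a s)]]
    (fun z => linear_mean_cvar d (master_of (base_of z)) (w_of z) (v_of z)).

Lemma linearized_problemE (R : realType) (N C S L : finType)
    (A : {set N * N}) (d : data R C S L A) (MQ MXi : link A -> S -> R) :
  linearized_problem d MQ MXi = box_linearized d (fun _ _ => 0) MQ MXi.
Proof.
congr Problem; apply/funext => z; apply/propext.
by split=> -[ext bnd prod]; split=> // a s;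
  have [/product_ineqsE ? /product_ineqsE ?] := prod a s.
Qed.

Lemma box_linearized_feasible (R : realType) (N C S L : finType)
    (A : {set N * N}) (d : data R C S L A) (l MQ MXi : link A -> S -> R) z :
  feasible (box_linearized d l MQ MXi) z <->
  [/\ feasible (extensive_problem d) (base_of z),
      @box R N C S A l MQ MXi (master_of (base_of z)),
      forall a s, w_of z a s =
        master_of (base_of z) (Y a) * master_of (base_of z) (Q s)
    & forall a s, v_of z a s =
        master_of (base_of z) (Y a) * master_of (base_of z) (Xi s)].
Proof.
split=> [[ext bnd prod]|[ext bnd wE vE]]; split=> // a s;
  have [Qb Xb] := bnd a s; have mY : binary (master_of (base_of z) (Y a))
    by (have [[]] := ext).
- by have [/(mccormickP _ mY Qb)] := prod a s.
- by have [_ /(mccormickP _ mY Xb)] := prod a s.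
- by split; [apply/(mccormickP _ mY Qb) | apply/(mccormickP _ mY Xb)].
Qed.

Lemma linear_mean_cvarE (R : realType) (N C S L : finType) (A : {set N * N})
    (d : data R C S L A) (m : mvar C S A -> R) (w v : link A -> S -> R) :
  (forall a s, w a s = m (Y a) * m (Q s)) ->
  (forall a s, v a s = m (Y a) * m (Xi s)) ->
  linear_mean_cvar d m w v = mean_cvar d m.
Proof.
move=> wE vE; rewrite /linear_mean_cvar /mean_cvar /prob.
congr (_ + _ * _ + _ * (_ + _ * _)); apply: eq_bigr => s _;
  rewrite mulrDl mulr_suml; congr (_ + _); apply: eq_bigr => a _.
  by rewrite wE mulrA.
by rewrite vE mulrA.
Qed.

Lemma box_linearized_objective (R : realType) (N C S L : finType)
    (A : {set N * N}) (d : data R C S L A) (l MQ MXi : link A -> S -> R) z :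
  feasible (box_linearized d l MQ MXi) z ->
  objective (box_linearized d l MQ MXi) z =
  objective (extensive_problem d) (base_of z).
Proof. by move=> /box_linearized_feasible[_ _ wE vE]; exact: linear_mean_cvarE. Qed.

(** The form in which a [milp] can express a binary variable: linear rows and integrality. *)
Lemma binaryE (R : realType) (x : R) :
  binary x <-> 0 <= x <= 1 /\ x \is a Num.int.
Proof.
split=> [[] ->|[/andP[x0 x1] /intrP[n nE]]]; rewrite ?lexx ?ler01//.
move: x0 x1; rewrite /binary {x}nE.
rewrite -[0]/(0%:~R) -[1]/(1%:~R) !ler_int => n0 n1.
by case: n n0 n1 => [[|[|n]]|n]//; [left|right].
Qed.

(** Once [{0, 1}] is relaxed to [[0, 1]], every constraint is affine in all the variables jointly;
    integrality of the [Y a] restores the rest. *)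
Lemma box_linearized_milp (R : realType) (N C S L : finType)
    (A : {set N * N}) (d : data R C S L A) (l MQ MXi : link A -> S -> R) :
  exists m : milp R (evar C S A + pvar S A)%type,
    [/\ milp_int m = [set inl (inl (Y a)) | a : link A]%SET,
        feasible (milp_problem m) = feasible (box_linearized d l MQ MXi)
      & objective (milp_problem m) = objective (box_linearized d l MQ MXi)].
Proof.
pose mz (z : evar C S A + pvar S A -> R) := master_of (base_of z).
(* Plain conjunctions replace the records so that [solve_polyhedral] can traverse them. *)
pose relaxed z :=
  (forall a, 0 <= mz z (Y a) <= 1) /\
  (forall i c, 0 <= mz z (W i c) <= storage d i c) /\
  (forall s, mz z (Q s) - mz z Nu <= mz z (Xi s) /\ 0 <= mz z (Xi s)) /\
  (forall s, recourse_feasible d (mz z) s (recourse_of (base_of z) s) /\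
     mz z (Q s) = recourse_cost d s (recourse_of (base_of z) s)) /\
  (forall a s, l a s <= mz z (Q s) <= MQ a s /\ 0 <= mz z (Xi s) <= MXi a s) /\
  (forall a s,
     (mz z (Q s) - MQ a s * (1 - mz z (Y a)) <= w_of z a s /\
      w_of z a s <= mz z (Q s) - l a s * (1 - mz z (Y a)) /\
      w_of z a s <= MQ a s * mz z (Y a) /\ l a s * mz z (Y a) <= w_of z a s) /\
     (mz z (Xi s) - MXi a s * (1 - mz z (Y a)) <= v_of z a s /\
      v_of z a s <= mz z (Xi s) - 0 * (1 - mz z (Y a)) /\
      v_of z a s <= MXi a s * mz z (Y a) /\ 0 * mz z (Y a) <= v_of z a s)).
have maff v : affine (fun z => mz z v) by exact: affine_coord.
have raff s v : affine (fun z : evar C S A + pvar S A -> R =>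
    recourse_of (base_of z) s v) by exact: affine_coord.
have [rows rowsE] : polyhedral relaxed.
  have costaff s := affine_recourse_cost d s (raff s).
  have recpol s := polyhedral_recourse d s maff (raff s).
  rewrite /relaxed.
  by solve_polyhedral.
have [k [b kE]] : affine (objective (box_linearized d l MQ MXi)).
  by rewrite /= /linear_mean_cvar; solve_affine.
(* The cost of a [milp] has no constant term; evaluation at the zero vector shows that none is
   needed here. *)
have b0 : b = 0.
  have := kE (fun=> 0); rewrite /= /linear_form [X in _ = X + _]big1; last first.
    by move=> v _; rewrite mulr0.
  rewrite add0r => <-; rewrite /linear_mean_cvar.
  have sum0 (I : finType) (c : I -> R) : \sum_i c i * 0 = 0.
    by rewrite big1// => i _; rewrite mulr0.
  rewrite !sum0 !big1 => [|s _|i _]; by rewrite ?(mulr0, sum0, addr0).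
exists (Milp k rows [set inl (inl (Y a)) | a : link A]%SET); split=> //=; last first.
  by apply/funext => z; rewrite -[LHS]addr0 -{1}b0 -kE.
apply/funext => z; apply/propext; split=> [[/rowsE]|].
  move=> [Y01 [Wb [risk [rec [bnd prod]]]]] int.
  split=> //; first split=> //; first split=> //.
    move=> a; apply/binaryE; split; first exact: Y01.
    by apply: int; apply: imset_f.
  by move=> a s; have [[? [? [? ?]]] [? [? [? ?]]]] := prod a s; split; split.
move=> [[[mY Wb] risk rec] bnd prod].
split; last by move=> _ /imsetP[a _ ->]; have /binaryE[] := mY a.
apply/rowsE; split; first by move=> a; have /binaryE[] := mY a.
do 4!split=> //.
by move=> a s; have [[? ? ? ?] [? ? ? ?]] := prod a s.
Qed.

(** Squeezing applies: a point of the program yields one of the two-stage problem by minimizing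
    recourse, and a point in the box lifts back with the same objective. *)
Lemma box_linearized_reformulation (R : realType) (N C S L : finType)
    (A : {set N * N}) (d : data R C S L A) (l MQ MXi : link A -> S -> R)
    (F : (link A -> R) -> (N -> C -> R) -> Prop) :
  assumptions d ->
  let P := add_constraint (mean_cvar_problem d) (@first_stage_in R N C S A F) in
  same_optimum P (add_constraint P (@box R N C S A l MQ MXi)) ->
  exact_reformulation P
    (add_constraint (box_linearized d l MQ MXi)
       [set z | @first_stage_in R N C S A F (master_of (base_of z))])
    (@decodes R N C S A (pvar S A)).
Proof.
move=> hd P valid; apply: squeezed_reformulation valid _ _.
  move=> z [zlin Fz]; have [ext _ _ _] := (box_linearized_feasible _ _ _ _ _).1 zlin.
  have [m [mfeas mle mE]] := extensive_to_mean_cvar hd ext; exists m; split=> //.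
    (* [F] is transferred because [m] and [z] agree on [Y] and [W]. *)
    split=> //; move: Fz; rewrite /first_stage_in /=.
    rewrite (_ : (fun a => m (Y a)) = fun a => master_of (base_of z) (Y a)).
      rewrite (_ : (fun i c => m (W i c)) = fun i c => master_of (base_of z) (W i c))//.
      by apply/funext => i; apply/funext => c; rewrite mE.
    by apply/funext => a; rewrite mE.
  by move: (box_linearized_objective zlin) => /= ->.
move=> m [mfeas Fm] mbox.
have [z0 z0ext z0m] := mean_cvar_to_extensive mfeas.
(* The auxiliary variables receive the true products, the only values that the inequalities admit in
   the box. *)
pose z v := match v with
  | inl v => z0 v
  | inr (inl (a, s)) => m (Y a) * m (Q s)
  | inr (inr (a, s)) => m (Y a) * m (Xi s) end.
have zm : master_of (base_of z) = m by [].
have zlin : feasible (box_linearized d l MQ MXi) z.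
  by apply/box_linearized_feasible; rewrite zm.
exists z; first by split=> //; rewrite /= zm.
by move: (box_linearized_objective zlin) => /= ->; rewrite zm.
Qed.

(** * Existence of an exact program without given bounds *)

Lemma add_constraintT (R : realType) T (P : problem R T) (B : set T) :
  (forall z, B z) -> add_constraint P B = P.
Proof.
case: P => F f BT; congr Problem.
by apply/seteqP; split=> z; [case | split].
Qed.

Lemma add_constraint_congr (R : realType) T (P P' : problem R T) (B : set T) :
  feasible P = feasible P' -> objective P = objective P' ->
  add_constraint P B = add_constraint P' B.
Proof. by rewrite /add_constraint => -> ->. Qed.

(** The box depends on [d] alone, so one program is fixed before [F] is given; clamping leaves [Y]
    and [W] unchanged and so respects every [F]. *)
Lemma mean_cvar_has_exact_milp (R : realType) (N C S L : finType)
    (A : {set N * N}) (d : data R C S L A) :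
  assumptions d ->
  exists m : milp R (evar C S A + pvar S A)%type, exact_milp d m.
Proof.
move=> hd; have [K K0 costK] := recourse_cost_bounded d.
pose cst (x : R) (_ : link A) (_ : S) := x.
have [m [_ mF mO]] := box_linearized_milp d (cst (- K)) (cst K) (cst (K + K)).
exists m => F; rewrite (add_constraint_congr _ mF mO).
apply: box_linearized_reformulation => //.
apply: same_optimum_restrict => z [[fs risk rec] Fz].
have QK s : - K <= z (Q s) <= K.
  by have [[r rs <-] _] := rec s; exact: costK rs.
exists (clamp_risk K z); split; last by case: fs => mY _; exact: mean_cvar_clamp_risk.
  split=> //; split=> // s; last exact: is_recourse_min_ext (rec s).
  by split=> /=; rewrite le_max lexx ?orbT.
move=> a s; rewrite /cst /= QK; split=> //.
have /andP[? ?] := QK s.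
rewrite le_max lexx/= ge_max; apply/andP; split; first lra.
(* From [Q_s <= K] and the clamped [nu >= - K], the new [xi_s] is at most [K + K]. *)
have : - K <= Num.max (- K) (Num.min K (z Nu)) by rewrite le_max lexx.
lra.
Qed.

Theorem proposition1 (R : realType) (N C S L : finType) (A : {set N * N})
    (d : data R C S L A) (hd : assumptions d) :
  (exists (Aux : finType) (m : milp R (evar C S A + Aux)%type), exact_milp d m)
  /\
  (forall MQ MXi y q xi w v : R,
     binary y -> 0 <= q <= MQ -> 0 <= xi <= MXi ->
     (product_ineqs MQ y q w /\ product_ineqs MXi y xi v <->
      w = y * q /\ v = y * xi))
  /\
  (forall MQ MXi : link A -> S -> R, valid_bounds d MQ MXi ->
     [/\ forall z,
           feasible (linearized_problem d MQ MXi) z <->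
           [/\ feasible (extensive_problem d) (base_of z),
               @within_bounds R N C S A MQ MXi (master_of (base_of z)),
               forall a s, w_of z a s =
                 master_of (base_of z) (Y a) * master_of (base_of z) (Q s)
             & forall a s, v_of z a s =
                 master_of (base_of z) (Y a) * master_of (base_of z) (Xi s)],
         forall z, feasible (linearized_problem d MQ MXi) z ->
           objective (linearized_problem d MQ MXi) z =
           objective (extensive_problem d) (base_of z)
       & exists m : milp R (evar C S A + pvar S A)%type,
           [/\ milp_int m = [set inl (inl (Y a)) | a : link A]%SET,
               feasible (milp_problem m) =
                 feasible (linearized_problem d MQ MXi),
               objective (milp_problem m) =
                 objective (linearized_problem d MQ MXi)
             & exact_reformulation (mean_cvar_problem d) (milp_problem m)
                 (@decodes R N C S A (pvar S A))]]).
Proof.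
split.
  by exists (link A * S + link A * S)%type; exact: mean_cvar_has_exact_milp.
split=> [MQ MXi y q xi w v yb qb xib|MQ MXi valid].
  split=> -[wE vE]; split.
  - by apply/(mccormickP _ yb qb)/product_ineqsE.
  - by apply/(mccormickP _ yb xib)/product_ineqsE.
  - by apply/product_ineqsE/(mccormickP _ yb qb).
  - by apply/product_ineqsE/(mccormickP _ yb xib).
rewrite linearized_problemE; split.
- exact: box_linearized_feasible.
- exact: box_linearized_objective.
have [m [mI mF mO]] := box_linearized_milp d (fun _ _ => 0) MQ MXi.
exists m; split=> //.
(* The side condition is made trivial to recover the unrestricted problem; with [l = 0] the box is
   [within_bounds], so [valid] is the hypothesis required. *)
pose anywhere (_ : link A -> R) (_ : N -> C -> R) := True.
have := box_linearized_reformulation (l := fun _ _ => 0) (MQ := MQ) (MXi := MXi)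
  (F := anywhere) hd.
rewrite /= (add_constraint_congr _ (esym mF) (esym mO)).
rewrite [add_constraint (milp_problem m) _]add_constraintT//.
by rewrite [add_constraint _ (first_stage_in _)]add_constraintT//; apply.
Qed.
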